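(* Let $(y_n)_{n\ge1}$ be a nondecreasing sequence of nonnegative integers, with output array $A(n,k)$ and output sequence $W(n)$. Then for $n\ge2$ and $0\le k\le y_n$, $$\min(y_{n-1}+1,\,k+1)\le A(n,k),$$ and for all $n\ge1$, $k\ge0$, $$A(n,k)\le\binom{n-1+k}{k},\qquad W(n)\le\binom{n+y_n}{y_n}.$$
   Context: For a nondecreasing sequence $(y_n)_{n\ge1}$ of nonnegative integers and a positive integer $n$, an $n$-tuple $(x_1,\dots,x_n)$ of nonnegative integers is valid if $x_1\le y_n$ and $x_{j+1}\le\min(x_j,y_{n-j})$ for $1\le j\le n-1$. The output array $A(n,k)$ ($n\ge1$, $k\ge0$) is the number of valid $n$-tuples with $x_1=k$, and the output sequence is $W(n)=\sum_{k\ge0}A(n,k)=\sum_{k=0}^{y_n}A(n,k)$, the number of valid $n$-tuples. *)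

(* Defs.v *)
From mathcomp Require Import all_boot.

Set Implicit Arguments.
Unset Strict Implicit.
Unset Printing Implicit Defensive.

(* A sequence (y_n)_{n >= 1} is a function y : nat -> nat; y 0 is never used. *)
Definition nondecreasing_from1 (y : nat -> nat) : Prop :=
  forall m n : nat, 1 <= m -> m <= n -> y m <= y n.

(* One-based coordinates of a tuple (x_1, ..., x_n). *)
Definition coord (n : nat) (x : n.-tuple nat) (j : nat) : nat := nth 0 x j.-1.

(* The index j : 'I_n with 1 <= j ranges over 1 <= j <= n - 1. *)
Definition valid (y : nat -> nat) (n : nat) (x : n.-tuple nat) : bool :=
  (coord x 1 <= y n) &&
  [forall j : 'I_n,
     (1 <= j) ==> (coord x j.+1 <= minn (coord x j) (y (n - j)))].

(* All entries of a valid tuple are at most y n, so valid tuples are counted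
   inside the finite type of n-tuples with entries in {0, ..., y n}; see
   outputAP and outputWP below, which show that no valid tuple is lost. *)
Definition nat_tuple (m n : nat) (x : n.-tuple 'I_m) : n.-tuple nat :=
  map_tuple val x.

Definition outputA (y : nat -> nat) (n k : nat) : nat :=
  #|[set x : n.-tuple 'I_(y n).+1 |
      valid y (nat_tuple x) && (coord (nat_tuple x) 1 == k)]|.

(* The terms A(n,k) with k > y n vanish (outputA_eq0). *)
Definition outputW (y : nat -> nat) (n : nat) : nat :=
  \sum_(0 <= k < (y n).+1) outputA y n k.

Lemma valid_bound (y : nat -> nat) (n : nat) (x : n.-tuple nat) (i : nat) :
  0 < n -> valid y x -> nth 0 x i <= y n.
Proof.
move=> n_gt0 /andP[x1 /forallP xS]; elim: i => [//|i IHi].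
have [lt_i|le_i] := ltnP i.+1 n; last by rewrite nth_default ?size_tuple.
have := xS (Ordinal lt_i); rewrite /= /coord /= leq_min => /andP[le_x _].
exact: leq_trans le_x IHi.
Qed.

Lemma outputA_eq0 (y : nat -> nat) (n k : nat) : y n < k -> outputA y n k = 0.
Proof.
move=> lt_k; apply/eqP; rewrite cards_eq0 -subset0; apply/subsetP => x.
rewrite inE => /andP[/andP[x1 _] /eqP xk].
by move: lt_k; rewrite -xk ltnNge x1.
Qed.

Lemma nat_tuple_inj (m n : nat) : injective (@nat_tuple m n).
Proof.
move=> x1 x2 /(congr1 val) /= eq_x; apply: val_inj.
exact: (inj_map val_inj) eq_x.
Qed.

Lemma valid_lift (y : nat -> nat) (n : nat) (x : n.-tuple nat) :
  0 < n -> valid y x -> exists x' : n.-tuple 'I_(y n).+1, nat_tuple x' = x.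
Proof.
move=> n_gt0 vx; exists (map_tuple inord x); apply: val_inj => /=.
rewrite -map_comp -[RHS]map_id; apply/eq_in_map => a /(nthP 0)[i _ <-] /=.
by rewrite inordK // ltnS valid_bound.
Qed.

Lemma enum_valid (y : nat -> nat) (n : nat) (P : pred (n.-tuple nat)) :
  0 < n ->
  exists s : seq (n.-tuple nat),
    [/\ uniq s, forall x, (x \in s) = valid y x && P x
      & size s = #|[set x : n.-tuple 'I_(y n).+1 |
                     valid y (nat_tuple x) && P (nat_tuple x)]|].
Proof.
move=> n_gt0; set S := [set x | _].
exists [seq nat_tuple x | x <- enum S]; split.
- by rewrite map_inj_uniq ?enum_uniq //; apply: nat_tuple_inj.
- move=> x; apply/mapP/idP => [[x' ]|].
    by rewrite mem_enum inE => Sx' ->.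
  move=> vPx; have /andP[vx _] := vPx.
  have [x' def_x] := valid_lift n_gt0 vx.
  by exists x'; rewrite ?mem_enum ?inE def_x.
- by rewrite size_map -cardE.
Qed.

Lemma outputAP (y : nat -> nat) (n k : nat) :
  0 < n ->
  exists s : seq (n.-tuple nat),
    [/\ uniq s, forall x, (x \in s) = valid y x && (coord x 1 == k)
      & size s = outputA y n k].
Proof. exact: (@enum_valid y n (fun x => coord x 1 == k)). Qed.

Lemma outputWP (y : nat -> nat) (n : nat) :
  0 < n ->
  exists s : seq (n.-tuple nat),
    [/\ uniq s, forall x, (x \in s) = valid y x & size s = outputW y n].
Proof.
move=> n_gt0; have [s [Us Ms Ss]] := @enum_valid y n predT n_gt0.
exists s; split=> //; first by move=> x; rewrite Ms andbT.
rewrite {}Ss /outputW big_mkord -sum1_card.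
rewrite (partition_big (fun x : n.-tuple 'I_(y n).+1 =>
           inord (coord (nat_tuple x) 1) : 'I_(y n).+1) predT) //=.
apply: eq_bigr => k _; rewrite /outputA -sum1_card; apply: eq_bigl => x.
rewrite !inE andbT; have [vx|//] := boolP (valid y (nat_tuple x)).
rewrite /= -val_eqE /= inordK // ltnS.
by case/andP: vx.
Qed.

(* Main.v *)
Require Import Defs.
From mathcomp Require Import all_boot.

(** Lower bound: the tuples [(k, j, 0, ..., 0)] with [j <= min(k, y (n - 1))]
    are valid. Upper bounds: a valid tuple is nonincreasing, so one starting
    with [k] is determined by the weakly increasing sequence of the [n - 1]
    differences [k - x_j] in [{0, ..., k}], and there are ['C(n - 1 + k, k)] of
    these; the bound on [W] follows by the hockey-stick identity. *)

Lemma valid_sorted (y : nat -> nat) (n : nat) (x : n.-tuple nat) :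
  valid y x -> sorted geq x.
Proof.
case/andP=> _ /forallP xS; apply/(sortedP 0) => i; rewrite size_tuple => lt_i.
by have := xS (Ordinal lt_i); rewrite /= /coord /= leq_min => /andP[].
Qed.

Lemma valid_two_entries (y : nat -> nat) (n k j : nat) :
  k <= y n.+2 -> j <= minn k (y n.+1) ->
  valid y [tuple of k :: j :: nseq n 0].
Proof.
(* Index 0 is vacuous and index 1 is [le_j]; every later entry is 0. *)
move=> le_k le_j; apply/andP; split=> //; apply/forallP=> -[[|[|i]] lt_i] //=.
by rewrite /coord /= nth_nseq if_same.
Qed.

Lemma outputA_ge (y : nat -> nat) (n k : nat) :
  k <= y n.+2 -> (minn k (y n.+1)).+1 <= outputA y n.+2 k.
Proof.
move=> le_k; have [s [_ Ms <-]] := @outputAP y n.+2 k isT.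
pose t j : n.+2.-tuple nat := [tuple of k :: j :: nseq n 0].
(* The bound becomes the length of the list of all [t j], which embeds in [s]. *)
rewrite -[X in X <= _](size_iota 0) -(size_map t).
apply: uniq_leq_size => [|_ /mapP[j j_in ->]].
  by rewrite map_inj_uniq ?iota_uniq // => i j /(congr1 val)[].
rewrite Ms [coord _ _]/= eqxx andbT valid_two_entries //.
by move: j_in; rewrite mem_iota.
Qed.

Lemma outputA_le (y : nat -> nat) (n k : nat) :
  outputA y n.+1 k <= 'C(n + k, k).
Proof.
have [s [Us Ms <-]] := @outputAP y n.+1 k isT.
(* Reflection in [k] reverses the order; [k - a] never exceeds [k], so [inord] does not truncate. *)
pose f (a : nat) : 'I_k.+1 := inord (k - a).
pose g (x : n.+1.-tuple nat) : n.-tuple 'I_k.+1 :=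
  map_tuple f (behead_tuple x).
have fE a : f a = k - a :> nat by rewrite inordK // ltnS leq_subr.
have tail_le x a : x \in s -> a \in behead x -> a <= k.
  rewrite Ms => /andP[/valid_sorted]; case/tupleP: x => b x /=.
  rewrite /coord /= (path_sortedE (rev_trans leq_trans)).
  by case/andP=> /allP le_b _ /eqP <- /le_b.
have g_inj : {in s &, injective g}.
  move=> x z xs zs /(congr1 val) /= eq_g.
  (* Entries are at most [k], so reflecting twice restores the tail; the head is always [k]. *)
  have tailK (w : n.+1.-tuple nat) :
      w \in s -> [seq k - val b | b <- map f (behead w)] = behead w.
    move=> ws; rewrite -map_comp -[RHS]map_id; apply/eq_in_map => a aw /=.
    by rewrite fE subKn // (tail_le w).
  have eq_t : behead x = behead z by rewrite -(tailK x) // eq_g tailK.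
  move: xs zs; rewrite !Ms => /andP[_ /eqP hx] /andP[_ /eqP hz].
  apply: val_inj; move: hx hz eq_t {eq_g}; rewrite /coord /=.
  by case/tupleP: x => b x; case/tupleP: z => c z /= -> -> ->.
(* By symmetry the bound is ['C(n + k, n)], the number of weakly increasing [n]-tuples over
   ['I_k.+1]. *)
rewrite -(size_map g) -bin_sub ?leq_addl // addnK -card_sorted_tuples.
rewrite cardE; apply: uniq_leq_size => [|_ /mapP[x xs ->]].
  by rewrite map_inj_in_uniq.
rewrite mem_enum inE /= -map_comp (eq_map (fE : val \o f =1 _)).
have sorted_t : sorted geq (behead x).
  move: xs; rewrite Ms => /andP[/valid_sorted + _].
  by case: (tval x) => // b t /path_sorted.
by apply: homo_sorted sorted_t => a b; apply: leq_sub2l.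
Qed.

(** Induction on [m]: the new last term completes Pascal's rule. *)
Lemma sum_bin_diag (n m : nat) :
  \sum_(0 <= k < m.+1) 'C(n + k, k) = 'C(n.+1 + m, m).
Proof.
elim: m => [|m IHm]; first by rewrite big_nat1 !bin0.
by rewrite big_nat_recr //= IHm !addnS !addSn [RHS]binS addnC.
Qed.

Theorem theorem5p1 (y : nat -> nat) (y_mono : nondecreasing_from1 y) :
  (forall n k : nat, 2 <= n -> k <= y n ->
     minn (y (n - 1) + 1) (k + 1) <= outputA y n k) /\
  (forall n k : nat, 1 <= n -> outputA y n k <= 'C(n - 1 + k, k)) /\
  (forall n : nat, 1 <= n -> outputW y n <= 'C(n + y n, y n)).
Proof.
split; [|split].
- case=> [|[|n]] // k _ le_k.
  by rewrite subn1 !addn1 minnSS minnC outputA_ge.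
- by case=> [//|n] k _; rewrite subn1 outputA_le.
- case=> [//|n] _; rewrite -sum_bin_diag.
  by apply: leq_sum => k _; apply: outputA_le.
Qed.
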